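(* Let $G$ be a distinguished group, let $A$ be a simple subgroup of $G$ of order $v$, let $p,q\in G$ and $H_{pq}=(A.p).(A.q)$. Let $\tau_1=p.q,\tau_2,\dots,\tau_v\in G$ be elements with $H_{pq}=\bigcup_{i=1}^v A.\tau_i$, where the $A.\tau_i$ are pairwise disjoint if $H_{pq}$ has $v^2$ elements. Then for all $k,l\in\{1,\dots,v\}$ $$(A.\tau_k).(A.\tau_l)=A.(\tau_k.\tau_l).$$
   Context: A distributive group is a nonempty set $G$ with a binary operation $(a,b)\mapsto a.b$ on $G$ such that for all $a,b\in G$ each of the equations $a.x=b$ and $y.a=b$ has exactly one solution in $G$, and for all $a,b,c\in G$, $(a.b).c=(a.c).(b.c)$ and $c.(a.b)=(c.a).(c.b)$. A subgroup of $G$ is a nonempty subset which is itself a distributive group under the restricted operation; the order is the number of elements. A distributive group is simple if it has no proper subgroup of order greater than one. For subsets $X,Y\subseteq G$ and $p\in G$: $X.Y=\{x.y: x\in X,\,y\in Y\}$, $X.p=\{x.p: x\in X\}$, $p.X=\{p.x:x\in X\}$. A finite distributive group $G$ is called distinguished if for every subgroup $B$ of $G$ and every $p\in G$, the sets $B.(B.p)$ and $(B.p).B$ are subgroups of the same order as $B$; equivalently there are $t,\tau\in G$ with $B.(B.p)=B.t$ and $(B.p).B=B.(p.B)=B.\tau$. In this setting the set $H_{pq}$ has $v$ or $v^2$ elements, is a subgroup of $G$, and elements $\tau_i$ as described always exist. *)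

(* Defs.v *)
From mathcomp Require Import all_boot.

Set Implicit Arguments.
Unset Strict Implicit.
Unset Printing Implicit Defensive.

Section DistributiveGroups.

Variables (T : finType) (op : T -> T -> T).

(* [A] is a distributive group under the restriction of [op]: in particular
   the solutions of both equations are sought, and unique, inside [A].
   The ambient group [G] is the case [A = [set: T]]. *)
Definition distributive_group (A : {set T}) : Prop :=
  [/\ A != set0,
      (forall a b, a \in A -> b \in A -> op a b \in A),
      (forall a b, a \in A -> b \in A ->
         (exists! x, x \in A /\ op a x = b) /\
         (exists! y, y \in A /\ op y a = b))
    & (forall a b c, a \in A -> b \in A -> c \in A ->
         op (op a b) c = op (op a c) (op b c) /\
         op c (op a b) = op (op c a) (op c b))].

Definition subgroup (B : {set T}) : Prop := distributive_group B.

Definition simple_dgroup (A : {set T}) : Prop :=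
  ~ (exists B : {set T}, [/\ subgroup B, B \proper A & 1 < #|B|]).

Definition setop (X Y : {set T}) : {set T} := [set op x y | x in X, y in Y].

Definition rtranslate (X : {set T}) (p : T) : {set T} := [set op x p | x in X].

Definition distinguished : Prop :=
  distributive_group [set: T] /\
  forall (B : {set T}) (p : T), subgroup B ->
    [/\ subgroup (setop B (rtranslate B p)),
        #|setop B (rtranslate B p)| = #|B|,
        subgroup (setop (rtranslate B p) B)
      & #|setop (rtranslate B p) B| = #|B|].

Definition Hset (A : {set T}) (p q : T) : {set T} :=
  setop (rtranslate A p) (rtranslate A q).

End DistributiveGroups.

(* Main.v *)
Require Import Defs.
From mathcomp Require Import all_boot.

(** Write [xy] for the operation and call [x, y, z, w] a medial quadruple when
    [(xy)(zw) = (xz)(yw)].  If [A] and the [tau i] lie in a common subgroup [S]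
    all of whose quadruples are medial, the theorem is immediate, since then
    [(a t)(b u) = (ab)(t u)].  Two facts provide such an [S].

    First, every subgroup with three generators is medial
    ([medial_generated_card_le3]).  Left and right translations are
    endomorphisms, and with three of the variables fixed the medial law
    equates two endomorphisms of the fourth; hence its solutions form a
    subgroup, and the law passes from generators to the whole subgroup, one
    variable at a time.  Among four elements of a set of three there is a
    repetition, and distributivity gives every repeated case except
    [(ev)(ue) = (eu)(ve)].  That last case also follows from the subgroup
    property, because [u] lies in the subgroup of [e] and [eu], and [e] in the
    subgroup of [u] and [eu] ([medial_outer]).

    Second, let [h] belong to [H_pq = (Ap)(Aq)], and let [S] be a subgroup
    containing [A] and [h].  Then [H_pq] is contained in [S] ([Hset_sub]).
    This is where the hypothesis that the group is distinguished enters: it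
    makes [S(Sq)] a single translate [Sc] for each [c] in [Sq], so that for
    [h = bc] the identity [(bc')c = (bc)(c'c)] puts [(bc')c] in [Sc], and the
    factor [c] cancels.

    A simple subgroup [A] has two generators [a, b].  The subgroup generated
    by [a, b, h] therefore has three generators, is medial, and contains [A],
    [H_pq] and every [tau i]. *)

Set Implicit Arguments.
Unset Strict Implicit.
Unset Printing Implicit Defensive.

Section FiniteDistributiveGroup.

Variables (T : finType) (op : T -> T -> T).
Hypothesis dG : distributive_group op [set: T].

Local Notation "x ** y" := (op x y) (at level 40, left associativity).

Implicit Types (x y z w : T) (A K S X : {set T}) (f g : T -> T).

(** * Cancellation, closed sets and generation *)

Lemma op_distr_r x y z : (x ** y) ** z = (x ** z) ** (y ** z).
Proof. by case: dG => _ _ _ /(_ x y z (in_setT _) (in_setT _) (in_setT _)) []. Qed.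

Lemma op_distr_l x y z : z ** (x ** y) = (z ** x) ** (z ** y).
Proof. by case: dG => _ _ _ /(_ x y z (in_setT _) (in_setT _) (in_setT _)) []. Qed.

Lemma op_injl x : injective (op x).
Proof.
move=> y z e; case: dG => _ _ /(_ x (x ** z) (in_setT _) (in_setT _)) sol _.
by case: sol => [[t [_ ut]] _]; rewrite -(ut y) ?(ut z) ?in_setT.
Qed.

Lemma op_injr x : injective (op^~ x).
Proof.
move=> y z e; case: dG => _ _ /(_ x (z ** x) (in_setT _) (in_setT _)) sol _.
by case: sol => [_ [t [_ ut]]]; rewrite -(ut y) ?(ut z) ?in_setT.
Qed.

Lemma op_idem x : x ** x = x.
Proof. by apply: (@op_injr (x ** x)); rewrite /= -op_distr_l. Qed.

Definition op_closed K := [forall x in K, forall y in K, x ** y \in K].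

Lemma op_closedP K :
  reflect {in K &, forall x y, x ** y \in K} (op_closed K).
Proof.
apply: (iffP forall_inP) => clK x; last by move=> Kx; apply/forall_inP=> y; apply: clK.
by move=> y /clK/forall_inP; apply.
Qed.

(** An injective self-map of a finite set is onto: finiteness makes division
    available inside closed sets. *)
Lemma inj_stable_surj K f :
    injective f -> {in K, forall x, f x \in K} ->
  {in K, forall y, exists2 x, x \in K & f x = y}.
Proof.
move=> inj_f Kf y Ky.
suff /imsetP[x Kx ->] : y \in f @: K by exists x.
have /eqP-> // : f @: K == K.
rewrite eqEcard card_imset // leqnn andbT.
by apply/subsetP=> _ /imsetP[x Kx ->]; apply: Kf.
Qed.

Lemma op_closed_divl K x y :
  op_closed K -> x \in K -> x ** y \in K -> y \in K.
Proof.
move=> /op_closedP clK Kx /(inj_stable_surj (@op_injl x) (fun z => clK _ z Kx)).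
by case=> z Kz /op_injl <-.
Qed.

Lemma op_closed_divr K x y :
  op_closed K -> x \in K -> y ** x \in K -> y \in K.
Proof.
move=> /op_closedP clK Kx.
move=> /(inj_stable_surj (@op_injr x) (fun z Kz => clK z _ Kz Kx)).
by case=> z Kz /op_injr <-.
Qed.

Lemma op_closed_subgroup K : K != set0 -> op_closed K -> subgroup op K.
Proof.
move=> K0 /op_closedP clK; split=> // [a b Ka Kb | a b c _ _ _]; last first.
  by split; [apply: op_distr_r | apply: op_distr_l].
split.
  have [x Kx xE] := inj_stable_surj (@op_injl a) (fun z => clK _ z Ka) Kb.
  by exists x; split=> // z [_ zE]; apply: (@op_injl a); rewrite xE zE.
have [y Ky yE] :=
  inj_stable_surj (@op_injr a) (fun z Kz => clK z _ Kz Ka) Kb.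
by exists y; split=> // z [_ zE]; apply: (@op_injr a); rewrite /= yE zE.
Qed.

Lemma subgroup_op_closed K : subgroup op K -> op_closed K.
Proof. by case=> _ clK _ _; apply/op_closedP. Qed.

Definition generated X := \bigcap_(K | op_closed K && (X \subset K)) K.

Lemma sub_generated X : X \subset generated X.
Proof. by apply/bigcapsP=> K /andP[]. Qed.

Lemma generated_sub X K : op_closed K -> X \subset K -> generated X \subset K.
Proof. by move=> clK sXK; apply: bigcap_inf; rewrite clK. Qed.

Lemma generated_op_closed X : op_closed (generated X).
Proof.
apply/op_closedP=> x y /bigcapP Xx /bigcapP Xy; apply/bigcapP=> K KP.
by have /andP[/op_closedP clK _] := KP; apply: clK; [apply: Xx | apply: Xy].
Qed.

(** * The medial law *)

Definition endo f := {morph f : x y / x ** y}.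

Lemma endo_opl x : endo (op x). Proof. by move=> y z; apply: op_distr_l. Qed.

Lemma endo_opr x : endo (op^~ x). Proof. by move=> y z; apply: op_distr_r. Qed.

Lemma endo_comp f g : endo f -> endo g -> endo (f \o g).
Proof. by move=> ef eg x y /=; rewrite eg ef. Qed.

Lemma equalizer_op_closed f g :
  endo f -> endo g -> op_closed [set x | f x == g x].
Proof.
move=> ef eg; apply/op_closedP=> x y; rewrite !inE => /eqP ex /eqP ey.
by rewrite ef eg ex ey.
Qed.

Definition medial x y z w := (x ** y) ** (z ** w) == (x ** z) ** (y ** w).

Lemma medial_closed1 y z w : op_closed [set x | medial x y z w].
Proof. by apply: equalizer_op_closed; apply: (endo_comp (endo_opr _) (endo_opr _)). Qed.

Lemma medial_closed2 x z w : op_closed [set y | medial x y z w].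
Proof.
apply: equalizer_op_closed; first exact: (endo_comp (endo_opr _) (endo_opl _)).
exact: (endo_comp (endo_opl _) (endo_opr _)).
Qed.

Lemma medial_closed3 x y w : op_closed [set z | medial x y z w].
Proof.
apply: equalizer_op_closed; first exact: (endo_comp (endo_opl _) (endo_opr _)).
exact: (endo_comp (endo_opr _) (endo_opl _)).
Qed.

Lemma medial_closed4 x y z : op_closed [set w | medial x y z w].
Proof. by apply: equalizer_op_closed; apply: (endo_comp (endo_opl _) (endo_opl _)). Qed.

Lemma medial_eq12 x z w : medial x x z w.
Proof. by apply/eqP; rewrite (op_idem x); apply: op_distr_l. Qed.

Lemma medial_eq13 x y w : medial x y x w.
Proof. by apply/eqP; rewrite (op_idem x) -op_distr_l. Qed.

Lemma medial_eq23 x y w : medial x y y w.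
Proof. exact: eqxx. Qed.

Lemma medial_eq24 x y z : medial x y z y.
Proof. by apply/eqP; rewrite (op_idem y) -op_distr_r. Qed.

Lemma medial_eq34 x y z : medial x y z z.
Proof. by apply/eqP; rewrite (op_idem z); apply: op_distr_r. Qed.

(** The one repeated case that is not an instance of distributivity.  In
    [medial x v u e] the law holds for [x = u], and also for [x = eu], because
    as a condition on the third entry [medial (eu) v _ e] holds at [eu] and at
    [e], hence at the quotient [u].  Dividing [eu] by [u] then yields
    [x = e]. *)
Lemma medial_outer e u v : medial e v u e.
Proof.
have third : medial (e ** u) v u e.
  suff : u \in [set z | medial (e ** u) v z e] by rewrite inE.
  by apply: (op_closed_divl (x := e)); rewrite ?medial_closed3 // inE
    ?medial_eq34 ?medial_eq13.
suff : e \in [set x | medial x v u e] by rewrite inE.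
by apply: (op_closed_divr (x := u)); rewrite ?medial_closed1 // inE
  ?medial_eq13.
Qed.

Lemma medial_of_card_le3 X :
  #|X| <= 3 -> {in X & X, forall x y, {in X & X, forall z w, medial x y z w}}.
Proof.
move=> X3 x y Xx Xy z w Xz Xw.
have : ~~ uniq [:: x; y; z; w].
  apply/negP=> uX; have /(uniq_leq_size uX) : {subset [:: x; y; z; w] <= enum X}.
    by apply/allP; rewrite /= !mem_enum Xx Xy Xz Xw.
  by rewrite -cardE; move/leq_trans/(_ X3).
rewrite /= !inE !negb_and !negbK !orbF !orbA -!orbA.
case/or4P => [/eqP->|/eqP->|/eqP->|]; first exact: medial_eq12.
- exact: medial_eq13.
- exact: medial_outer.
by case/or3P=> /eqP->;
  [apply: medial_eq23 | apply: medial_eq24 | apply: medial_eq34].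
Qed.

(** The law passes from [X] to [generated X] one entry at a time; an entry
    already extended stays universally quantified over [generated X]. *)
Lemma medial_generated_card_le3 X :
    #|X| <= 3 ->
  {in generated X & generated X, forall x y,
    {in generated X & generated X, forall z w, medial x y z w}}.
Proof.
move=> /medial_of_card_le3 mX.
have step (P : pred T) : op_closed [set x | P x] ->
    {in X, forall x, P x} -> {in generated X, forall x, P x}.
  move=> clP XP x; suff /subsetP sub : generated X \subset [set x | P x].
    by move/sub; rewrite inE.
  by apply: generated_sub => //; apply/subsetP=> t Xt; rewrite inE XP.
move=> x y Gx Gy z w Gz Gw; move: x Gx.
apply: (step) => [|x Xx]; first exact: medial_closed1.
move: y Gy; apply: (step) => [|y Xy]; first exact: medial_closed2.
move: z Gz; apply: (step) => [|z Xz]; first exact: medial_closed3.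
move: w Gw; apply: (step) => [|w Xw]; first exact: medial_closed4.
exact: mX.
Qed.

(** * Simple subgroups and the sets H_pq *)

(** Two distinct elements of [A] generate a subgroup of order greater than
    one, hence all of [A].  The order-one case, where no two such elements
    exist, is absorbed by allowing [a = b]. *)
Lemma simple_generated A :
    subgroup op A -> simple_dgroup op A ->
  exists a b, A = generated [set a; b].
Proof.
move=> sA simA; have clA := subgroup_op_closed sA.
have [/set0Pn[a Aa] _ _ _] := sA.
have genA b : b \in A -> generated [set a; b] \subset A.
  by move=> Ab; apply: generated_sub => //; rewrite subUset !sub1set Aa.
have [A1 | A_gt1] := leqP #|A| 1.
  exists a, a; apply/eqP; rewrite eq_sym eqEcard genA //= (leq_trans A1) //.
  apply/card_gt0P; exists a; apply: (subsetP (sub_generated _)).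
  by rewrite !inE eqxx.
have [b Ab neq_ab] : exists2 b, b \in A & b != a.
  have : 0 < #|A :\ a| by move: A_gt1; rewrite (cardsD1 a) Aa.
  by case/card_gt0P=> b /setD1P[neq Ab]; exists b.
exists a, b; set B := generated _.
have sabB : [set a; b] \subset B := sub_generated _.
have B_gt1 : 1 < #|B|.
  by rewrite (leq_trans _ (subset_leq_card sabB)) // cards2 eq_sym neq_ab.
apply/eqP; rewrite eq_sym eqEproper genA //; apply/negP=> prBA; apply: simA.
exists B; split=> //; apply: op_closed_subgroup (generated_op_closed _).
by apply/set0Pn/card_gt0P/ltnW.
Qed.

Lemma mem_rtranslate X p x : x \in X -> x ** p \in rtranslate op X p.
Proof. by move=> Xx; apply: imset_f. Qed.

(** A factor [Sq] may be replaced by any of its elements: the product has as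
    many elements as [S], hence as any translate that it contains. *)
Lemma distinguished_mulr S q x c :
    distinguished op -> subgroup op S -> c \in rtranslate op S q ->
  x \in setop op S (rtranslate op S q) -> exists2 s, s \in S & x = s ** c.
Proof.
move=> [_ dist] sS Sc; have [_ cardS _ _] := dist S q sS.
suff /eqP<- : rtranslate op S c == setop op S (rtranslate op S q).
  by case/imsetP=> s Ss ->; exists s.
rewrite eqEcard cardS card_imset ?leqnn ?andbT; last exact: op_injr.
by apply/subsetP=> _ /imsetP[s Ss ->]; apply: imset2_f.
Qed.

Lemma distinguished_mull S p x b :
    distinguished op -> subgroup op S -> b \in rtranslate op S p ->
  x \in setop op (rtranslate op S p) S -> exists2 s, s \in S & x = b ** s.
Proof.
move=> [_ dist] sS Sb; have [_ _ _ cardS] := dist S p sS.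
suff /eqP<- : op b @: S == setop op (rtranslate op S p) S.
  by case/imsetP=> s Ss ->; exists s.
rewrite eqEcard cardS card_imset ?leqnn ?andbT; last exact: op_injl.
by apply/subsetP=> _ /imsetP[s Ss ->]; apply: imset2_f.
Qed.

(** A subgroup containing [A] and one element of [H_pq] contains [H_pq]:
    by the two cancellations below, each factor of that element may be
    changed separately within its translate of [A]. *)
Lemma Hset_sub A S p q h :
    distinguished op -> subgroup op S -> A \subset S -> op_closed A ->
    h \in Hset op A p q -> h \in S ->
  Hset op A p q \subset S.
Proof.
move=> dist sS /subsetP sAS /op_closedP clA.
case/imset2P=> _ _ /imsetP[a Aa ->] /imsetP[b Ab ->] ->{h} Sh.
have right_factor a1 b1 b2 : b1 \in A -> b2 \in A ->
    (a1 ** p) ** (b1 ** q) \in S -> (a1 ** p) ** (b2 ** q) \in S.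
  move=> Ab1 Ab2 Sab; have Sc := mem_rtranslate q (sAS _ Ab1).
  set x := (a1 ** p) ** (b2 ** q); set c := b1 ** q in Sab Sc.
  (* With d = a1 p: (d (b2 q)) c = (d c) ((b2 b1) q), which is in S(Sq) = Sc. *)
  have [|s Ss /op_injr-> //] := distinguished_mulr (x := x ** c) dist sS Sc.
  rewrite op_distr_r -[b2 ** q ** c]op_distr_r; apply: imset2_f => //.
  by apply: mem_rtranslate; apply/sAS/clA.
have left_factor a1 a2 b1 : a1 \in A -> a2 \in A ->
    (a1 ** p) ** (b1 ** q) \in S -> (a2 ** p) ** (b1 ** q) \in S.
  move=> Aa1 Aa2 Sab; have Sc := mem_rtranslate p (sAS _ Aa1).
  set x := (a2 ** p) ** (b1 ** q); set c := a1 ** p in Sab Sc.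
  (* With d = b1 q: c ((a2 p) d) = ((a1 a2) p) (c d), which is in (Sp)S = cS. *)
  have [|s Ss /op_injl-> //] := distinguished_mull (x := c ** x) dist sS Sc.
  rewrite op_distr_l -[c ** (a2 ** p)]op_distr_r; apply: imset2_f => //.
  by apply: mem_rtranslate; apply/sAS/clA.
apply/subsetP=> _ /imset2P[_ _ /imsetP[a' Aa' ->] /imsetP[b' Ab' ->] ->].
exact: (right_factor _ b) (left_factor a _ _ _ _ Sh).
Qed.

End FiniteDistributiveGroup.

Theorem theorem5p10 (T : finType) (op : T -> T -> T)
    (hG : distinguished op)
    (A : {set T}) (v : nat)
    (hA : subgroup op A) (hAs : simple_dgroup op A) (hv : #|A| = v)
    (p q : T) (tau : 'I_v -> T)
    (htau1 : forall i : 'I_v, nat_of_ord i = 0 -> tau i = op p q)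
    (hcover : Hset op A p q = \bigcup_(i < v) rtranslate op A (tau i))
    (hdisj : #|Hset op A p q| = v ^ 2 ->
       forall i j : 'I_v, i != j ->
         [disjoint rtranslate op A (tau i) & rtranslate op A (tau j)]) :
  forall k l : 'I_v,
    setop op (rtranslate op A (tau k)) (rtranslate op A (tau l)) =
    rtranslate op A (op (tau k) (tau l)).
Proof.
move=> k l; have [dG _] := hG.
have [a [b AE]] := simple_generated dG hA hAs.
have clA := subgroup_op_closed hA.
have Aa : a \in A by rewrite AE (subsetP (sub_generated _ _)) // !inE eqxx.
pose h := op (op a p) (op a q); pose X := [set a; b] :|: [set h].
pose S := generated op X.
have clS : op_closed op S := generated_op_closed _ _.
have sXS : X \subset S := sub_generated _ _.
have sAS : A \subset S.
  by rewrite AE generated_sub // (subset_trans _ sXS) // subsetUl.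
have Sh : h \in S by rewrite (subsetP sXS) // !inE eqxx orbT.
have sS : subgroup op S.
  by apply: op_closed_subgroup => //; apply/set0Pn; exists h.
have Hh : h \in Hset op A p q by apply: imset2_f; apply: mem_rtranslate.
have sHS := Hset_sub dG hG sS sAS clA Hh Sh.
have Stau i : tau i \in S.
  apply: (op_closed_divl dG clS (subsetP sAS _ Aa)); apply: (subsetP sHS).
  by rewrite hcover; apply/bigcupP; exists i => //; apply: mem_rtranslate.
have X3 : #|X| <= 3.
  rewrite (leq_trans (leq_card_setU _ _)) // cards1 addn1 ltnS cards2.
  by case: (_ != _).
have med x y : x \in A -> y \in A ->
    op (op x (tau k)) (op y (tau l)) = op (op x y) (op (tau k) (tau l)).
  move=> Ax Ay; apply/eqP.
  by apply: (medial_generated_card_le3 dG X3); rewrite ?Stau ?(subsetP sAS).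
apply/setP=> t; apply/imset2P/imsetP.
  case=> _ _ /imsetP[x Ax ->] /imsetP[y Ay ->] ->; exists (op x y); last exact: med.
  exact: (op_closedP _ _ clA).
case=> x Ax ->; exists (op x (tau k)) (op x (tau l)); try exact: mem_rtranslate.
by rewrite med // (op_idem dG).
Qed.
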